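(* Let $(M,g,J)$ be a Kähler manifold with Levi-Civita connection $\nabla$, let $Q$ be a tensor field of type $(1,2)$ on $M$, and let $\overline{\nabla}$ be the complex connection $$\overline{\nabla}_XY=\nabla_XY+\tfrac12\left(Q(X,Y)-JQ(X,JY)\right).$$ Let $A=\overline{\nabla}-\nabla$, i.e. $A(X,Y)=\frac12\left(Q(X,Y)-JQ(X,JY)\right)$. Then $(M,g,A)$ is a weak Frobenius structure if and only if for every $X,Y,Z\in\mathcal{X}(M)$ $$g(Q(X,Y),Z)-g(Q(Y,Z),X)=g(Q(Y,JZ),JX)-g(Q(X,JY),JZ).$$
   Context: $\mathcal{X}(M)$ denotes the smooth vector fields on $M$. A linear connection $\overline{\nabla}$ on $(M,J)$ is called a complex connection if $\overline{\nabla}J=0$. For a Riemannian metric $g$ on $M$ and a tensor field $A$ of type $(1,2)$, the triple $(M,g,A)$ is called a weak Frobenius structure if $g(A(X,Y),Z)=g(X,A(Y,Z))$ for all $X,Y,Z\in\mathcal{X}(M)$ (no symmetry of $A$ is required). *)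

(* Defs.v *)
From HB Require Import structures.
From mathcomp Require Import all_boot all_order all_algebra.
From mathcomp Require Import all_classical all_reals all_analysis.
From mathcomp Require Import ring lra.

Set Implicit Arguments.
Unset Strict Implicit.
Unset Printing Implicit Defensive.

Import Order.TTheory GRing.Theory Num.Theory numFieldNormedType.Exports.
Local Open Scope classical_set_scope.
Local Open Scope ring_scope.

(* Tangent vectors at p are derivations of C^oo(M) at p; a tensor field is a
   family of multilinear maps of the tangent spaces that sends smooth vector
   fields to smooth vector fields (or functions). *)

Section Euclidean.
Variables (R : realType) (n : nat).
Implicit Types (U : set 'rV[R]_n) (f g : 'rV[R]_n -> R).

(* meant for an open U; only the germs of f at the points of U matter *)
Fixpoint Ck (k : nat) U f : Prop :=
  (forall x, U x -> {for x, continuous f}) /\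
  if k is k'.+1 then
    forall i : 'I_n, (forall x, U x -> derivable f x (delta_mx 0 i)) /\
                     Ck k' U ('D_(delta_mx 0 i) f)
  else True.

Definition smooth_on U f := forall k, Ck k U f.

Lemma Ck_ext k U f g : open U -> (forall x, U x -> f x = g x) ->
  Ck k U f -> Ck k U g.
Proof.
move=> oU; elim: k f g => [|k IH] f g fg [cf df].
all: have nfg x : U x -> \forall y \near x, f y = g y
  by move=> Ux; move: (open_nbhs_nbhs (conj oU Ux)); apply: filterS => y; exact: fg.
all: have cg x : U x -> {for x, continuous g}
  by move=> Ux; rewrite /prop_for /continuous_at -(fg x Ux);
     apply: cvg_trans (cf x Ux); exact: (@near_eq_cvg _ _ (nbhs x) _ f g (nfg x Ux)).
  by split.
split=> // i; have [dfi Cfi] := df i; split.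
  by move=> x Ux; apply: near_eq_derivable (dfi _ Ux); exact: nfg.
by apply: IH Cfi => x Ux; apply: near_eq_derive; exact: nfg.
Qed.

Lemma CkW k U f : Ck k.+1 U f -> Ck k U f.
Proof.
elim: k f => [|k IH] f [cf df]; first by split.
by split=> // i; have [dfi Cfi] := df i; split => //; exact: IH.
Qed.

Lemma Ck_cst k U (a : R) : open U -> Ck k U (cst a).
Proof.
move=> oU; elim: k a => [|k IH] a.
  by split=> // x _; exact: cst_continuous.
split; first by move=> x _; exact: cst_continuous.
move=> i; split; first by move=> x _; exact: derivable_cst.
by apply: Ck_ext (IH 0) => // x Ux; rewrite derive_cst.
Qed.

Lemma CkD k U f g : open U -> Ck k U f -> Ck k U g -> Ck k U (f + g).
Proof.
move=> oU; elim: k f g => [|k IH] f g [cf df] [cg dg].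
  by split=> // x Ux; apply: continuousD; [exact: cf|exact: cg].
split; first by move=> x Ux; apply: continuousD; [exact: cf|exact: cg].
move=> i; have [dfi Cfi] := df i; have [dgi Cgi] := dg i; split.
  by move=> x Ux; apply: derivableD; [exact: dfi|exact: dgi].
apply: Ck_ext (IH _ _ Cfi Cgi) => // x Ux.
by rewrite deriveD; [|exact: dfi|exact: dgi].
Qed.

Lemma CkM k U f g : open U -> Ck k U f -> Ck k U g -> Ck k U (f * g).
Proof.
move=> oU; elim: k f g => [|k IH] f g Cf Cg.
  have [[cf _] [cg _]] := (Cf, Cg).
  by split=> // x Ux; apply: continuousM; [exact: cf|exact: cg].
have [[cf df] [cg dg]] := (Cf, Cg).
split; first by move=> x Ux; apply: continuousM; [exact: cf|exact: cg].
move=> i; have [dfi Cfi] := df i; have [dgi Cgi] := dg i; split.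
  by move=> x Ux; apply: derivableM; [exact: dfi|exact: dgi].
apply: Ck_ext (CkD oU (IH _ _ (CkW Cf) Cgi) (IH _ _ (CkW Cg) Cfi)) => // x Ux.
by rewrite deriveM; [|exact: dfi|exact: dgi].
Qed.

End Euclidean.

(* chart_map is a homeomorphism from chart_dom onto an open set, with inverse
   chart_inv; both are total functions, irrelevant outside these sets. *)
Record chart (R : realType) (n : nat) (T : topologicalType) := Chart {
  chart_dom : set T;
  chart_map :> T -> 'rV[R]_n;
  chart_inv : 'rV[R]_n -> T;
  chart_dom_open : open chart_dom;
  chart_img_open : open (chart_map @` chart_dom);
  chart_mapK : forall p, chart_dom p -> chart_inv (chart_map p) = p;
  chart_map_cont : forall p, chart_dom p -> {for p, continuous chart_map};
  chart_inv_cont : forall x, (chart_map @` chart_dom) x ->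
    {for x, continuous chart_inv}
}.

Definition chart_img R n T (c : chart R n T) := c @` chart_dom c.

(* The atlas need not be maximal, and M need not be connected. *)
Record manifold (R : realType) (n : nat) := Manifold {
  carrier :> topologicalType;
  manifold_hausdorff : hausdorff_space carrier;
  manifold_second_countable : @second_countable carrier;
  atlas : set (chart R n carrier);
  atlas_cover : forall p : carrier, exists2 c, atlas c & chart_dom c p;
  atlas_compat : forall c d, atlas c -> atlas d -> forall j : 'I_n,
    smooth_on (c @` (chart_dom c `&` chart_dom d))
              (fun x => d (chart_inv c x) 0 j)
}.

Section Functions.
Variables (R : realType) (n : nat) (M : manifold R n).
Implicit Types f : M -> R.

Definition smooth f := forall c, atlas c ->
  smooth_on (chart_img c) (f \o chart_inv c).

Definition smooth_pred : {pred M -> R} := fun f => `[< smooth f >].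

Lemma smooth_cst (a : R) : smooth (fun _ => a).
Proof. by move=> c _ k; apply: Ck_cst; exact: chart_img_open. Qed.

Lemma smoothD (f g : M -> R) : smooth f -> smooth g -> smooth (f + g).
Proof.
move=> sf sg c ac k; apply: CkD; first exact: chart_img_open.
  exact: sf.
exact: sg.
Qed.

Lemma smoothM (f g : M -> R) : smooth f -> smooth g -> smooth (f * g).
Proof.
move=> sf sg c ac k; apply: CkM; first exact: chart_img_open.
  exact: sf.
exact: sg.
Qed.

Lemma smoothZ (a : R) (f : M -> R) : smooth f -> smooth (a *: f).
Proof. by move=> sf; exact: (smoothM (smooth_cst a) sf). Qed.

Lemma smoothN (f : M -> R) : smooth f -> smooth (- f).
Proof. by move=> sf; rewrite -scaleN1r; exact: smoothZ. Qed.

Fact smooth_subring_closed : subring_closed smooth_pred.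
Proof.
split=> [|f g|f g]; first exact/asboolP/smooth_cst.
  by move=> /asboolP sf /asboolP sg; apply/asboolP/smoothD => //; exact: smoothN.
by move=> /asboolP sf /asboolP sg; apply/asboolP/smoothM.
Qed.
HB.instance Definition _ :=
  GRing.isSubringClosed.Build _ smooth_pred smooth_subring_closed.

Fact smooth_scaler_closed : scaler_closed smooth_pred.
Proof. by move=> a f /asboolP sf; apply/asboolP/smoothZ. Qed.
HB.instance Definition _ :=
  GRing.isScaleClosed.Build _ _ smooth_pred smooth_scaler_closed.

Record smooth_fun := SmoothFun {
  smooth_val :> M -> R; smooth_valP : smooth_val \in smooth_pred }.
HB.instance Definition _ := [isSub for smooth_val].
HB.instance Definition _ := [Choice of smooth_fun by <:].
HB.instance Definition _ := 
  GRing.SubChoice_isSubComPzRing.Build _ _ smooth_fun smooth_subring_closed.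
HB.instance Definition _ := [SubZmodule_isSubLmodule of smooth_fun by <:].

End Functions.
Notation "'C^oo' M" := (smooth_fun M) (at level 8, M at level 2).

Definition smooth_const (R : realType) n (M : manifold R n) (a : R) : C^oo M :=
  SmoothFun (asboolT (@smooth_cst R n M a) : (fun=> a) \in @smooth_pred R n M).

Lemma smooth_funP (R : realType) n (M : manifold R n) (f : C^oo M) : smooth f.
Proof. by case: f => f /= /asboolP. Qed.

Section Tangent.
Variables (R : realType) (n : nat) (M : manifold R n) (p : M).

Definition derivation_at (v : C^oo M -> R) : Prop :=
  scalar v /\ forall f g : C^oo M, v (f * g) = f p * v g + g p * v f.

Definition derivation_pred : {pred C^oo M -> R} :=
  fun v => `[< derivation_at v >].

Fact derivation_submod_closed : submod_closed derivation_pred.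
Proof.
split.
  apply/asboolP; split; first by move=> a f g; rewrite /= mulr0 addr0.
  by move=> f g /=; rewrite !mulr0 addr0.
move=> a u v /asboolP[lu du] /asboolP[lv dv]; apply/asboolP.
have E f : (a *: u + v) f = a * u f + v f by [].
by split=> [b f g|f g]; rewrite !E ?(lu, lv, du, dv); ring.
Qed.
HB.instance Definition _ :=
  GRing.isSubmodClosed.Build _ _ derivation_pred derivation_submod_closed.

Record tangent := Tangent {
  tangent_val :> C^oo M -> R; tangent_valP : tangent_val \in derivation_pred }.
HB.instance Definition _ := [isSub for tangent_val].
HB.instance Definition _ := [Choice of tangent by <:].
HB.instance Definition _ := [SubChoice_isSubLmodule of tangent by <:].

End Tangent.

Section VectorFields.
Variables (R : realType) (n : nat) (M : manifold R n).

Record vfield := VField {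
  vf_at : forall p : M, tangent p;
  vf_smooth : forall f : C^oo M, smooth (fun p => vf_at p f) }.

Implicit Types (X Y Z : vfield) (f : C^oo M) (p : M).

Lemma vfieldP X Y : (forall p f, vf_at X p f = vf_at Y p f) <-> X = Y.
Proof.
split=> [XY|->//]; case: X Y XY => [X sX] [Y sY] /= XY.
suff E : X = Y by rewrite E in sX *; congr VField; exact: Prop_irrelevance.
by apply/functional_extensionality_dep => p; apply/val_inj/funext => f; exact: XY.
Qed.

HB.instance Definition _ := gen_eqMixin vfield.
HB.instance Definition _ := gen_choiceMixin vfield.

Fact vf0_smooth f : smooth (fun p => (0 : tangent p) f).
Proof. exact: smooth_cst. Qed.
Definition vf0 := VField vf0_smooth.

Fact vfN_smooth X f : smooth (fun p => (- vf_at X p) f).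
Proof. exact: smoothN (@vf_smooth X f). Qed.
Definition vfN X := VField (vfN_smooth X).

Fact vfD_smooth X Y f : smooth (fun p => (vf_at X p + vf_at Y p) f).
Proof. exact: smoothD (@vf_smooth X f) (@vf_smooth Y f). Qed.
Definition vfD X Y := VField (vfD_smooth X Y).

Fact vfZ_smooth (h : C^oo M) X f : smooth (fun p => (h p *: vf_at X p) f).
Proof. exact: smoothM (@smooth_funP _ _ _ h) (@vf_smooth X f). Qed.
Definition vfZ (h : C^oo M) X := VField (vfZ_smooth h X).

Fact vfDA : associative vfD.
Proof. by move=> X Y Z; apply/vfieldP => p f; exact: addrA. Qed.
Fact vfDC : commutative vfD.
Proof. by move=> X Y; apply/vfieldP => p f; exact: addrC. Qed.
Fact vf0D : left_id vf0 vfD.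
Proof. by move=> X; apply/vfieldP => p f; exact: add0r. Qed.
Fact vfND : left_inverse vf0 vfN vfD.
Proof. by move=> X; apply/vfieldP => p f; exact: addNr. Qed.
HB.instance Definition _ := GRing.isZmodule.Build vfield vfDA vfDC vf0D vfND.

Lemma vfZE (h : C^oo M) X p f : vf_at (vfZ h X) p f = h p * vf_at X p f.
Proof. by []. Qed.

Fact vfZA (a b : C^oo M) X : vfZ a (vfZ b X) = vfZ (a * b) X.
Proof. by apply/vfieldP => p f; rewrite !vfZE mulrA. Qed.
Fact vf1Z : left_id 1 vfZ.
Proof. by move=> X; apply/vfieldP => p f; rewrite vfZE mul1r. Qed.
Fact vfZDr : right_distributive vfZ +%R.
Proof. by move=> a X Y; apply/vfieldP => p f; exact: mulrDr. Qed.
Fact vfZDl X : {morph vfZ^~ X : a b / a + b}.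
Proof.
move=> a b; apply/vfieldP => p f.
by rewrite vfZE [(a + b : C^oo M) p]/(a p + b p) mulrDl.
Qed.
HB.instance Definition _ :=
  GRing.Zmodule_isLmodule.Build (C^oo M) vfield vfZA vf1Z vfZDr vfZDl.

(* the action of a vector field on functions: (X f)(p) = X_p f *)
Definition vf_app X f : C^oo M := SmoothFun (asboolT (@vf_smooth X f)).

Lemma tangentP p (v : tangent p) : derivation_at p v.
Proof. exact/asboolP/tangent_valP. Qed.

Lemma vf_app_scalar (a : R) X f h :
  vf_app X (a *: f + h) = a *: vf_app X f + vf_app X h.
Proof.
apply/val_inj/funext => p; have [lX _] := tangentP (vf_at X p).
exact: lX.
Qed.

Lemma vf_appM X f h : vf_app X (f * h) = f * vf_app X h + h * vf_app X f.
Proof.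
apply/val_inj/funext => p; have [_ dX] := tangentP (vf_at X p).
exact: dX.
Qed.

Fact lie_derivation X Y p :
  (fun f => vf_at X p (vf_app Y f) - vf_at Y p (vf_app X f))
    \in @derivation_pred R n M p.
Proof.
have [lX dX] := tangentP (vf_at X p); have [lY dY] := tangentP (vf_at Y p).
have aX f h : vf_at X p (f + h) = vf_at X p f + vf_at X p h.
  by have := lX 1 f h; rewrite scale1r /GRing.scale/= mul1r.
have aY f h : vf_at Y p (f + h) = vf_at Y p f + vf_at Y p h.
  by have := lY 1 f h; rewrite scale1r /GRing.scale/= mul1r.
apply/asboolP; split=> [a f h|f h].
  by rewrite !vf_app_scalar lX lY; ring.
rewrite !vf_appM aX aY !dX !dY /=; ring.
Qed.
Definition lie_at X Y p : tangent p := Tangent (lie_derivation X Y p).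

Fact lie_smooth X Y f : smooth (fun p => lie_at X Y p f).
Proof.
exact: smoothD (@vf_smooth X (vf_app Y f)) (smoothN (@vf_smooth Y (vf_app X f))).
Qed.
Definition lie X Y := VField (lie_smooth X Y).

End VectorFields.

Section Tensors.
Variables (R : realType) (n : nat) (M : manifold R n).
Implicit Types (X Y Z : vfield M) (f : C^oo M) (p : M).

Record tensor11 := Tensor11 {
  t11_at : forall p, {linear tangent p -> tangent p};
  t11_smooth : forall X f, smooth (fun p => t11_at p (vf_at X p) f) }.

Definition t11_app (T : tensor11) X : vfield M := VField (t11_smooth T X).

Record tensor12 := Tensor12 {
  t12_at : forall p, {bilinear tangent p -> tangent p -> tangent p};
  t12_smooth : forall X Y f,
    smooth (fun p => t12_at p (vf_at X p) (vf_at Y p) f) }.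

Definition t12_app (T : tensor12) X Y : vfield M := VField (t12_smooth T X Y).

Record riemannian_metric := RMetric {
  rmetric_at : forall p, {biscalar (@tangent R n M p)};
  rmetric_sym : forall p u v, rmetric_at p u v = rmetric_at p v u;
  rmetric_pos : forall p u, u != 0 -> 0 < rmetric_at p u u;
  rmetric_smooth : forall X Y,
    smooth (fun p => rmetric_at p (vf_at X p) (vf_at Y p)) }.

Definition rmetric_app (g : riemannian_metric) X Y : C^oo M :=
  SmoothFun (asboolT (rmetric_smooth g X Y)).

Record connection := Connection {
  conn_app : vfield M -> vfield M -> vfield M;
  (* linearity over the ring C^oo(M) *)
  conn_linear : forall Y, linear (conn_app^~ Y);
  conn_additive : forall X Y Z, conn_app X (Y + Z) = conn_app X Y + conn_app X Z;
  conn_leibniz : forall X f Y,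
    conn_app X (f *: Y) = vf_app X f *: Y + f *: conn_app X Y }.

End Tensors.

Coercion vf_app : vfield >-> Funclass.
Coercion t11_app : tensor11 >-> Funclass.
Coercion t12_app : tensor12 >-> Funclass.
Coercion rmetric_app : riemannian_metric >-> Funclass.
Coercion conn_app : connection >-> Funclass.

Section Structures.
Variables (R : realType) (n : nat) (M : manifold R n).
Implicit Types (g : riemannian_metric M) (J : tensor11 M) (A Q : tensor12 M)
  (D : connection M).

Definition torsion_free D :=
  forall X Y : vfield M, D X Y - D Y X = lie X Y.

Definition metric_compatible g D :=
  forall X Y Z : vfield M, X (g Y Z) = g (D X Y) Z + g Y (D X Z).

Definition levi_civita g D := torsion_free D /\ metric_compatible g D.

Definition almost_complex J :=
  forall (p : M) (v : tangent p), t11_at J p (t11_at J p v) = - v.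

Definition hermitian_metric g J := forall (p : M) (u v : tangent p),
  rmetric_at g p (t11_at J p u) (t11_at J p v) = rmetric_at g p u v.

(* (D_X J) Y = D_X (J Y) - J (D_X Y) *)
Definition complex_connection J D :=
  forall X Y : vfield M, D X (J Y) - J (D X Y) = 0.

(* Almost Hermitian with the Levi-Civita connection satisfying (nabla J) = 0;
   D below is unique (levi_civita_unique), cf. kahler_parallel. *)
Definition kahler g J :=
  [/\ almost_complex J, hermitian_metric g J &
      exists2 D, levi_civita g D & complex_connection J D].

Definition weak_frobenius g A :=
  forall X Y Z : vfield M, g (A X Y) Z = g X (A Y Z).

End Structures.

Section LeviCivita.
Variables (R : realType) (n : nat) (M : manifold R n).

Lemma metric_nondegenerate (g : riemannian_metric M) (W : vfield M) :
  g W W = 0 -> W = 0.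
Proof.
move=> gW; apply/vfieldP => p f.
have [->//|Wp0] := eqVneq (vf_at W p) 0.
have : g W W p = 0 by rewrite gW.
by move=> /= E; have := rmetric_pos g Wp0; rewrite E ltxx.
Qed.

Lemma levi_civita_unique (g : riemannian_metric M) (D D' : connection M) :
  levi_civita g D -> levi_civita g D' -> forall X Y, D X Y = D' X Y.
Proof.
move=> [tD mD] [tD' mD'] X Y; apply/eqP; rewrite -subr_eq0; apply/eqP.
have sym U V : D U V - D' U V = D V U - D' V U.
  have := tD U V; rewrite -(tD' U V) => /eqP; rewrite subr_eq => /eqP ->.
  by rewrite -addrA addrC addrA addrNK addrC.
pose s U V W p := rmetric_at g p (vf_at (D U V - D' U V) p) (vf_at W p).
have s12 U V W p : s U V W p = s V U W p by rewrite /s sym.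
have s23 U V W p : s U V W p = - s U W V p.
  have := congr1 (fun h : C^oo M => h p) (mD U V W).
  have := congr1 (fun h : C^oo M => h p) (mD' U V W).
  rewrite [X in _ = X -> _]/= [X in _ -> _ = X -> _]/=.
  rewrite [X in _ = X -> _](_ : _ =
    rmetric_at g p (vf_at (D' U V) p) (vf_at W p) +
    rmetric_at g p (vf_at V p) (vf_at (D' U W) p)) //.
  rewrite [X in _ -> _ = X -> _](_ : _ =
    rmetric_at g p (vf_at (D U V) p) (vf_at W p) +
    rmetric_at g p (vf_at V p) (vf_at (D U W) p)) //.
  move=> -> E; have B a b : vf_at (a - b) p = vf_at a p - vf_at b p by [].
  rewrite /s !B !linearBl; move: E; rewrite !(rmetric_sym g (vf_at V p)).
  have L (a b c d : R) : a + b = c + d -> c - a = - (d - b) by move=> ?; lra.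
  exact: L.
set W := D X Y - D' X Y.
apply: (@metric_nondegenerate g); apply/val_inj/funext => p.
have L (a : R) : a = - a -> a = 0 by move=> ?; lra.
apply: (L (s X Y W p)).
by rewrite {1}s23 (s12 X W) (s23 W X) (s12 W Y) (s23 Y W) (s12 Y X) opprK.
Qed.

Lemma kahler_parallel (g : riemannian_metric M) (J : tensor11 M) (D : connection M) :
  kahler g J -> levi_civita g D -> complex_connection J D.
Proof.
move=> [_ _ [D' lcD' cD']] lcD X Y.
by rewrite !(levi_civita_unique lcD lcD'); exact: cD'.
Qed.

End LeviCivita.

(* For every Kaehler structure and every Q there are a complex connection
   nabla + 1/2 (Q(X,Y) - J Q(X,JY)) and a tensor field which is its difference
   with nabla. *)
Section Complexification.
Variables (R : realType) (n : nat) (M : manifold R n).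
Variables (J : tensor11 M) (Q : tensor12 M).

Definition cpart_at p (u v : @tangent R n M p) : tangent p :=
  2^-1 *: (t12_at Q p u v - t11_at J p (t12_at Q p u (t11_at J p v))).

Fact cpart_bilinear p : bilinear_for
  (GRing.Scale.Law.clone _ _ *:%R _) (GRing.Scale.Law.clone _ _ *:%R _)
  (@cpart_at p).
Proof.
have ZC (a b : R) (w : @tangent R n M p) : a *: (b *: w) = b *: (a *: w).
  by rewrite !scalerA mulrC.
split=> [v a u u'|u a v v']; rewrite /cpart_at.
  by rewrite !(linearPl, linearP) addrACA -scalerDr [LHS]scalerDr ZC.
by rewrite !(linearPr, linearP) addrACA -scalerDr [LHS]scalerDr ZC.
Qed.
HB.instance Definition _ p := bilinear_isBilinear.Build R
  (@tangent R n M p) (@tangent R n M p) (@tangent R n M p) _ _ (@cpart_at p)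
  (@cpart_bilinear p).

Fact cpart_smooth (X Y : vfield M) (f : C^oo M) :
  smooth (fun p => cpart_at (vf_at X p) (vf_at Y p) f).
Proof.
exact: (@vf_smooth _ _ _ (smooth_const M 2^-1 *: (Q X Y - J (Q X (J Y)))) f).
Qed.
Definition cpart : tensor12 M :=
  @Tensor12 R n M (fun p => @cpart_at p) cpart_smooth.

Lemma cpartE X Y : cpart X Y = smooth_const M 2^-1 *: (Q X Y - J (Q X (J Y))).
Proof. exact/vfieldP. Qed.

Lemma t11_appZ (T : tensor11 M) (f : C^oo M) X : T (f *: X) = f *: T X.
Proof. by apply/vfieldP => p h /=; rewrite linearZ. Qed.

Lemma t11_appB (T : tensor11 M) X Y : T (X - Y) = T X - T Y.
Proof. by apply/vfieldP => p h /=; rewrite linearB. Qed.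

Lemma t12_appPl (T : tensor12 M) (f : C^oo M) X X' Y :
  T (f *: X + X') Y = f *: T X Y + T X' Y.
Proof. by apply/vfieldP => p h /=; rewrite linearPl. Qed.

Lemma t12_appPr (T : tensor12 M) (f : C^oo M) X Y Y' :
  T X (f *: Y + Y') = f *: T X Y + T X Y'.
Proof. by apply/vfieldP => p h /=; rewrite linearPr. Qed.

Variable D : connection M.

Definition shift_app X Y := D X Y + cpart X Y.

Fact shift_linear Y : linear (shift_app^~ Y).
Proof.
by move=> f X X'; rewrite /shift_app conn_linear t12_appPl scalerDr addrACA.
Qed.

Fact shift_additive X Y Z :
  shift_app X (Y + Z) = shift_app X Y + shift_app X Z.
Proof.
rewrite /shift_app conn_additive -[in cpart X _](scale1r Y) t12_appPr scale1r.
by rewrite addrACA.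
Qed.

Fact shift_leibniz X f Y :
  shift_app X (f *: Y) = X f *: Y + f *: shift_app X Y.
Proof.
rewrite /shift_app conn_leibniz scalerDr addrA; congr (_ + _).
have E := t12_appPr cpart 1 X 0 0; rewrite !scale1r addr0 in E.
have c0 : cpart X 0 = 0 by apply: (addrI (cpart X 0)); rewrite addr0 -E.
by rewrite -[f *: Y]addr0 t12_appPr c0 addr0.
Qed.

Definition shift : connection M :=
  Connection shift_linear shift_additive shift_leibniz.

Lemma shiftE X Y :
  shift X Y = D X Y + smooth_const M 2^-1 *: (Q X Y - J (Q X (J Y))).
Proof. by rewrite -cpartE. Qed.

Lemma cpart_difference X Y : cpart X Y = shift X Y - D X Y.
Proof. by rewrite /shift /= /shift_app addrC addKr. Qed.

Lemma shift_complex (g : riemannian_metric M) :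
  kahler g J -> levi_civita g D -> complex_connection J shift.
Proof.
move=> hK hLC X Y; have [JJ _ _] := hK.
have JV Z : J (J Z) = - Z by apply/vfieldP => p f /=; rewrite JJ.
have QN Z : Q X (- Z) = - Q X Z by apply/vfieldP => p f /=; rewrite linearNr.
have JN Z : J (- Z) = - J Z by apply/vfieldP => p f /=; rewrite linearN.
have JD Z W : J (Z + W) = J Z + J W.
  by rewrite -{1}[W]opprK t11_appB JN opprK.
rewrite !shiftE JD t11_appZ t11_appB !JV QN JN !opprK.
rewrite opprD addrACA (kahler_parallel hK hLC) add0r [J (Q X Y) + _]addrC.
exact: subrr.
Qed.

End Complexification.

(* Main.v *)
Require Import Defs.
From mathcomp Require Import all_boot all_order all_algebra.
From mathcomp Require Import all_classical all_reals all_analysis.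
From mathcomp Require Import lra.

Import GRing.Theory.
Local Open Scope ring_scope.

(** Since $J$ is skew for $g$ ([hermitian_skew]), moving it across the metric gives
    $2g(A(X,Y),Z)=g(Q(X,Y),Z)+g(Q(X,JY),JZ)$ ([rmetric_cpart]). By symmetry of $g$ the same formula
    computes $g(X,A(Y,Z))=g(A(Y,Z),X)$. Equating the two and rearranging gives exactly the stated
    identity, triple by triple. *)

(** Apply the isometry $J$ to both arguments of $g(Ju,v)$, then use $J^2=-1$. *)
Lemma hermitian_skew (R : realType) (n : nat) (M : manifold R n)
    (g : riemannian_metric M) (J : tensor11 M) (p : M) (u v : tangent p) :
  almost_complex J -> hermitian_metric g J ->
  rmetric_at g p (t11_at J p u) v = - rmetric_at g p u (t11_at J p v).
Proof. by move=> JJ gJ; rewrite -gJ JJ linearNl. Qed.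

(** Skewness turns the minus sign of $-JQ(X,JY)$ into a plus when $J$ passes to [Z]. *)
Lemma rmetric_cpart (R : realType) (n : nat) (M : manifold R n)
    (g : riemannian_metric M) (J : tensor11 M) (Q : tensor12 M)
    (X Y Z : vfield M) (p : M) :
  almost_complex J -> hermitian_metric g J ->
  g (cpart J Q X Y) Z p = 2^-1 * (g (Q X Y) Z p + g (Q X (J Y)) (J Z) p).
Proof.
move=> JJ gJ; rewrite /= /cpart_at linearZl_LR linearBl /=.
by rewrite hermitian_skew // opprK.
Qed.

Theorem proposition3p7 (R : realType) (n : nat) (M : manifold R n)
    (g : riemannian_metric M) (J : tensor11 M) (hK : kahler g J)
    (nabla : connection M) (hLC : levi_civita g nabla)
    (Q : tensor12 M)
    (nablab : connection M) (hcomplex : complex_connection J nablab)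
    (hnablab : forall X Y : vfield M,
      nablab X Y = nabla X Y +
        smooth_const M 2^-1 *: (Q X Y - J (Q X (J Y))))
    (A : tensor12 M)
    (hA : forall X Y : vfield M, A X Y = nablab X Y - nabla X Y) :
  weak_frobenius g A <->
  forall X Y Z : vfield M,
    g (Q X Y) Z - g (Q Y Z) X = g (Q Y (J Z)) (J X) - g (Q X (J Y)) (J Z).
Proof.
have [JJ gJ _] := hK.
have AE X Y : A X Y = cpart J Q X Y by rewrite hA hnablab -cpartE addrC addKr.
have gA X Y Z p :
    g (A X Y) Z p = 2^-1 * (g (Q X Y) Z p + g (Q X (J Y)) (J Z) p).
  by rewrite AE rmetric_cpart.
have gC X Y : g X Y = g Y X by apply/val_inj/funext => p; exact: rmetric_sym.
have subE (a b : C^oo M) p : (a - b) p = a p - b p by [].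
(* Evaluating at [p] turns equations in [C^oo M] into real ones, linear in four values of [g], hence
   within reach of [lra]. *)
split=> h X Y Z; apply/val_inj/funext => p;
  have := congr1 (fun f : C^oo M => f p) (h X Y Z).
  (* [gC X] puts [A Y Z] in the first slot of [g], where [gA] applies. *)
  by rewrite (gC X) !gA => E; rewrite [LHS]subE [RHS]subE; lra.
by rewrite [LHS]subE [RHS]subE => E; rewrite (gC X) [LHS]gA [RHS]gA; lra.
Qed.
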